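(* Let $0<q\in\mathbb{Q}$, $\gamma\in\mathbb{N}$, $\delta\in\mathbb{N}\cup\{0\}$ and $N\in\mathbb{N}$. The summation formula $$\sum_{n=0}^{\infty}((\gamma n+\delta)!)^{\gamma n+\delta-1}x^{\gamma n}\left\{\frac{[(\gamma(n+1)+\delta)!]^{\gamma}\,\big((\gamma n+\delta+1)_{\gamma}\big)^{\gamma n+\delta-1}}{q+[(\gamma(n+1)+\delta)!]^{N(\gamma(n+1)+\delta)}}\,x^{\gamma}-\frac{1}{q+((\gamma n+\delta)!)^{N(\gamma n+\delta)}}\right\}=-\frac{(\delta!)^{\delta-1}}{q+(\delta!)^{N\delta}}$$ is valid for all non-zero $x\in\mathbb{R}$ (with the sum taken in $\mathbb{R}$), and for all non-zero $x\in\mathbb{Q}_p$ (with the sum taken in $\mathbb{Q}_p$) for every prime $p$.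
   Context: $\mathbb{N}$ denotes the positive integers. $(\gamma n+\delta+1)_{\gamma}=(\gamma n+\delta+1)(\gamma n+\delta+2)\cdots(\gamma n+\delta+\gamma)$. $\mathbb{Q}_p$ is the field of $p$-adic numbers with its $p$-adic absolute value. *)

(* Defs.v *)
From HB Require Import structures.
From mathcomp Require Import all_boot all_order all_algebra.
From mathcomp Require Import ring lra.
From mathcomp Require Import boolp classical_sets functions reals topology.
From mathcomp Require Import normedtype sequences.
Set Implicit Arguments.
Unset Strict Implicit.
Unset Printing Implicit Defensive.
Import Order.TTheory GRing.Theory Num.Theory.
Import numFieldNormedType.Exports.
Local Open Scope classical_set_scope.
Local Open Scope ring_scope.

Definition padic_val (p : nat) (r : rat) : int :=
  (logn p `|numq r|%N)%:Z - (logn p `|denq r|%N)%:Z.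

(* When p is not prime, logn p is constantly 0, so this is the trivial absolute
   value; hence the construction below goes through for every p. *)
Definition padic_absq (p : nat) (r : rat) : rat :=
  if r == 0 then 0 else p%:R ^ (- padic_val p r).

Section PadicAbsq.
Variable p : nat.
Local Notation val_p := (padic_val p).
Local Notation abs_p := (padic_absq p).

Lemma padic_val_frac (a b : int) : a != 0 -> b != 0 ->
  val_p (a%:~R / b%:~R) = (logn p `|a|%N)%:Z - (logn p `|b|%N)%:Z.
Proof.
move=> a0 b0; rewrite /padic_val; set r : rat := _ / _.
have r0 : r != 0 by rewrite mulf_neq0 ?invr_eq0 ?intr_eq0.
have E : numq r * b = a * denq r.
  apply: (@intr_inj rat); rewrite !rmorphM /=.
  have -> : a%:~R = r * b%:~R :> rat by rewrite divfK ?intr_eq0.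
  have -> : (numq r)%:~R = r * (denq r)%:~R :> rat by rewrite numqE.
  by rewrite mulrAC.
have := congr1 (fun z => logn p `|z|%N) E.
rewrite /= !abszM !lognM ?absz_gt0 ?denq_neq0 ?numq_eq0 // => H.
apply/eqP; rewrite subr_eq addrAC eq_sym subr_eq -!PoszD -H.
by rewrite addnC.
Qed.

Lemma padic_valM (r s : rat) : r != 0 -> s != 0 ->
  val_p (r * s) = val_p r + val_p s.
Proof.
move=> r0 s0.
rewrite -{1}(divq_num_den r) -{1}(divq_num_den s) mulf_div -!rmorphM /=.
rewrite padic_val_frac ?mulf_neq0 ?numq_eq0 ?denq_neq0 //.
rewrite !abszM !lognM ?absz_gt0 ?numq_eq0 ?denq_neq0 // /padic_val !PoszD; ring.
Qed.

Lemma logn_absD (a b : int) : a + b != 0 -> a != 0 -> b != 0 ->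
  (minn (logn p `|a|%N) (logn p `|b|%N) <= logn p `|(a + b)%R|%N)%N.
Proof.
move=> ab0 a0 b0; have [pp|npp] := boolP (prime p); last first.
  have L n : logn p n = 0%N by rewrite lognE (negbTE npp).
  by rewrite !L.
rewrite -pfactor_dvdn ?absz_gt0 //.
suff : ((p ^ minn (logn p `|a|%N) (logn p `|b|%N))%N%:Z %| a + b)%Z by [].
apply: rpredD; rewrite dvdzE /= pfactor_dvdn ?absz_gt0 //.
  exact: geq_minl.
exact: geq_minr.
Qed.

Lemma padic_valD (r s : rat) : r + s != 0 -> r != 0 -> s != 0 ->
  val_p r <= val_p (r + s) \/ val_p s <= val_p (r + s).
Proof.
move=> rs0 r0 s0.
set A := numq r * denq s; set B := numq s * denq r.
have A0 : A != 0 by rewrite mulf_neq0 ?numq_eq0 ?denq_neq0.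
have B0 : B != 0 by rewrite mulf_neq0 ?numq_eq0 ?denq_neq0.
have D0 : denq r * denq s != 0 by rewrite mulf_neq0 ?denq_neq0.
have Er : r = A%:~R / (denq r * denq s)%:~R.
  rewrite !rmorphM /= -mulf_div divff ?intr_eq0 ?denq_neq0 //.
  by rewrite mulr1 divq_num_den.
have Es : s = B%:~R / (denq r * denq s)%:~R.
  rewrite [denq r * _]mulrC !rmorphM /= -mulf_div divff ?intr_eq0 ?denq_neq0 //.
  by rewrite mulr1 divq_num_den.
have Ers : r + s = (A + B)%:~R / (denq r * denq s)%:~R.
  by rewrite rmorphD mulrDl -Er -Es.
have AB0 : A + B != 0.
  by apply: contraNneq rs0 => AB; rewrite Ers AB mul0r.
have := logn_absD AB0 A0 B0.
have vr := padic_val_frac A0 D0; rewrite -Er in vr.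
have vs := padic_val_frac B0 D0; rewrite -Es in vs.
rewrite Ers vr vs padic_val_frac // !lerD2r !lez_nat geq_min.
by case/orP; [left|right].
Qed.

Lemma padic_absq0 : abs_p 0 = 0.
Proof. by rewrite /padic_absq eqxx. Qed.

Lemma padic_base (r : rat) : r != 0 -> (0 < p)%N \/ val_p r = 0.
Proof.
move=> r0; case: (posnP p) => [p0|]; last by left.
have L n : logn p n = 0%N by rewrite p0 lognE.
by right; rewrite /padic_val !L subrr.
Qed.

Lemma padic_absq_gt0 (r : rat) : r != 0 -> 0 < abs_p r.
Proof.
move=> r0; rewrite /padic_absq (negbTE r0).
case: (padic_base r0) => [p0|->]; last by rewrite oppr0 expr0z.
by apply: exprz_gt0; rewrite ltr0n.
Qed.

Lemma padic_absq_ge0 (r : rat) : 0 <= abs_p r.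
Proof.
have [->|r0] := eqVneq r 0; first by rewrite padic_absq0.
exact: ltW (padic_absq_gt0 r0).
Qed.

Lemma padic_absqM (r s : rat) : abs_p (r * s) = abs_p r * abs_p s.
Proof.
have [->|r0] := eqVneq r 0; first by rewrite mul0r padic_absq0 mul0r.
have [->|s0] := eqVneq s 0; first by rewrite mulr0 padic_absq0 mulr0.
rewrite /padic_absq (negbTE r0) (negbTE s0) mulf_eq0 (negbTE r0) (negbTE s0) /=.
rewrite padic_valM // opprD; case: (posnP p) => [p0|p0]; last first.
  by rewrite expfzDr // pnatr_eq0 -lt0n.
have h t : t != 0 -> val_p t = 0 by move=> /padic_base; rewrite p0; case.
by rewrite !h // oppr0 addr0 expr0z mulr1.
Qed.

Lemma padic_absq1 : abs_p 1 = 1.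
Proof.
apply: (mulfI (lt0r_neq0 (padic_absq_gt0 (oner_neq0 _)))).
by rewrite -padic_absqM !mulr1.
Qed.

Lemma padic_absqN (r : rat) : abs_p (- r) = abs_p r.
Proof. by rewrite /padic_absq /padic_val oppr_eq0 numqN denqN abszN. Qed.

Lemma padic_absqB (r s : rat) : abs_p (r - s) = abs_p (s - r).
Proof. by rewrite -padic_absqN opprB. Qed.

Lemma padic_absqV (r : rat) : abs_p r^-1 = (abs_p r)^-1.
Proof.
have [->|r0] := eqVneq r 0; first by rewrite padic_absq0 !invr0 padic_absq0.
apply: (mulfI (lt0r_neq0 (padic_absq_gt0 r0))).
by rewrite -padic_absqM !divff ?padic_absq1 // (lt0r_neq0 (padic_absq_gt0 r0)).
Qed.

Lemma padic_absqD (r s : rat) : abs_p (r + s) <= Num.max (abs_p r) (abs_p s).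
Proof.
have [->|r0] := eqVneq r 0; first by rewrite add0r le_max lexx orbT.
have [->|s0] := eqVneq s 0; first by rewrite addr0 le_max lexx.
have [->|rs0] := eqVneq (r + s) 0.
  by rewrite padic_absq0 le_max padic_absq_ge0.
rewrite /padic_absq (negbTE r0) (negbTE s0) (negbTE rs0) le_max.
case: (padic_base rs0) => [p0|]; last first.
  case: (posnP p) => [p0 _|p0 _].
    have h t : t != 0 -> val_p t = 0 by move=> /padic_base; rewrite p0; case.
    by rewrite !h // lexx.
  have p1 : 1 <= p%:R :> rat by rewrite ler1n.
  by case: (padic_valD rs0 r0 s0) => h; apply/orP; [left|right];
    apply: ler_weXz2l => //; rewrite lerN2.
have p1 : 1 <= p%:R :> rat by rewrite ler1n.
by case: (padic_valD rs0 r0 s0) => h; apply/orP; [left|right];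
  apply: ler_weXz2l => //; rewrite lerN2.
Qed.

Lemma padic_absqD_lt (r s e : rat) :
  abs_p r < e -> abs_p s < e -> abs_p (r + s) < e.
Proof.
by move=> re se; apply: le_lt_trans (padic_absqD r s) _; rewrite gt_max re.
Qed.

End PadicAbsq.

Definition is_padic_cauchy (p : nat) (u : nat -> rat) : Prop :=
  forall e : rat, 0 < e -> exists M : nat, forall m n : nat,
    (M <= m)%N -> (M <= n)%N -> padic_absq p (u m - u n) < e.

Definition is_padic_null (p : nat) (u : nat -> rat) : Prop :=
  forall e : rat, 0 < e -> exists M : nat, forall n : nat,
    (M <= n)%N -> padic_absq p (u n) < e.

Definition padic_cauchy_pred (p : nat) : {pred nat -> rat} :=
  fun u => `[< is_padic_cauchy p u >].

Section CauchyRing.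
Variable p : nat.
Local Notation abs_p := (padic_absq p).

Lemma padic_cauchy_bounded (u : nat -> rat) : is_padic_cauchy p u ->
  exists2 B : rat, 0 < B & exists M : nat, forall n, (M <= n)%N -> abs_p (u n) < B.
Proof.
move=> /(_ 1 ltr01)[M hM]; exists (abs_p (u M) + 1).
  by rewrite ltr_wpDl ?padic_absq_ge0.
exists M => n Mn; rewrite -(subrK (u M) (u n)).
apply: padic_absqD_lt; last by rewrite ltrDl.
by apply: lt_le_trans (hM _ _ Mn (leqnn _)) _; rewrite lerDr padic_absq_ge0.
Qed.

Lemma padic_cauchyM (u v : nat -> rat) :
  is_padic_cauchy p u -> is_padic_cauchy p v -> is_padic_cauchy p (u * v).
Proof.
move=> cu cv e e0.
have [B B0 [Mu hu]] := padic_cauchy_bounded cu.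
have [C C0 [Mv hv]] := padic_cauchy_bounded cv.
have [M1 h1] := cu _ (divr_gt0 e0 C0).
have [M2 h2] := cv _ (divr_gt0 e0 B0).
exists (maxn (maxn Mu Mv) (maxn M1 M2)) => m n.
rewrite !geq_max => /andP[/andP[um vm] /andP[m1 m2]].
move=> /andP[/andP[un vn] /andP[n1 n2]].
have -> : (u * v) m - (u * v) n = u m * (v m - v n) + v n * (u m - u n).
  have E k : (u * v) k = u k * v k by [].
  by rewrite !E; ring.
apply: padic_absqD_lt; rewrite padic_absqM.
  rewrite -[ltRHS](divfK (lt0r_neq0 B0)) mulrC.
  by apply: ltr_pM; rewrite ?padic_absq_ge0 ?hu ?h2.
rewrite -[ltRHS](divfK (lt0r_neq0 C0)) mulrC.
by apply: ltr_pM; rewrite ?padic_absq_ge0 ?hv ?h1.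
Qed.

Lemma padic_cauchy_subring : subring_closed (padic_cauchy_pred p).
Proof.
split=> [|u v /asboolP cu /asboolP cv|u v /asboolP cu /asboolP cv].
- by apply/asboolP => e e0; exists 0 => m n _ _; rewrite subrr padic_absq0.
- apply/asboolP => e e0; have [M hM] := cu e e0; have [K hK] := cv e e0.
  exists (maxn M K) => m n; rewrite !geq_max => /andP[Mm Km] /andP[Mn Kn].
  have -> : (u - v) m - (u - v) n = (u m - u n) + (v n - v m).
    have E k : (u - v) k = u k - v k by [].
    by rewrite !E; ring.
  by apply: padic_absqD_lt; [exact: hM|exact: hK].
- by apply/asboolP; exact: padic_cauchyM.
Qed.

HB.instance Definition _ :=
  GRing.isSubringClosed.Build (nat -> rat) (padic_cauchy_pred p)
    padic_cauchy_subring.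

End CauchyRing.

Record padic_cauchy (p : nat) := PadicCauchy {
  cauchy_seq :> nat -> rat;
  _ : cauchy_seq \in padic_cauchy_pred p
}.

HB.instance Definition _ p := [isSub for @cauchy_seq p].
HB.instance Definition _ p := [Choice of padic_cauchy p by <:].
HB.instance Definition _ p :=
  [SubChoice_isSubComNzRing of padic_cauchy p by <:].

Lemma padic_cauchyP p (u : padic_cauchy p) : is_padic_cauchy p u.
Proof. by apply/asboolP; case: u. Qed.

Definition padic_null (p : nat) : {pred padic_cauchy p} :=
  fun u => `[< is_padic_null p u >].

Lemma padic_null_idealr p : idealr_closed (@padic_null p).
Proof.
split.
- by apply/asboolP => e e0; exists 0 => n _; rewrite padic_absq0.
- apply/negP => /asboolP /(_ 1 ltr01)[M /(_ M (leqnn M))].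
  by rewrite padic_absq1 ltxx.
- move=> a u v /asboolP nu /asboolP nv; apply/asboolP => e e0.
  have [B B0 [K hK]] := padic_cauchy_bounded (padic_cauchyP a).
  have [M1 h1] := nu _ (divr_gt0 e0 B0); have [M2 h2] := nv _ e0.
  exists (maxn K (maxn M1 M2)) => n; rewrite !geq_max => /and3P[Kn n1 n2].
  apply: padic_absqD_lt (h2 _ n2).
  rewrite padic_absqM -[ltRHS](divfK (lt0r_neq0 B0)) mulrC.
  by rewrite [ltRHS]mulrC mulrC; apply: ltr_pM; rewrite ?padic_absq_ge0 ?hK ?h1.
Qed.

HB.instance Definition _ p :=
  isIdealr.Build (padic_cauchy p) (@padic_null p) (@padic_null_idealr p).

(* The field Q_p for p prime; Q itself otherwise. *)
Definition padic (p : nat) : Type := {ideal_quot @padic_null p}.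

HB.instance Definition _ p := GRing.ComNzRing.on (padic p).
HB.instance Definition _ p := NzRingQuotient.on (padic p).

Section PadicField.
Variable p : nat.
Local Notation abs_p := (padic_absq p).

Lemma padic_not_null (u : padic_cauchy p) : u \notin @padic_null p ->
  exists2 e : rat, 0 < e &
    exists M : nat, forall n, (M <= n)%N -> e <= abs_p (u n).
Proof.
move=> nu.
have [e [e0 he]] : exists e : rat, 0 < e /\
    forall M : nat, exists2 n, (M <= n)%N & e <= abs_p (u n).
  apply: contrapT => H; move/negP: nu; apply; apply/asboolP => e e0.
  apply: contrapT => K; apply: H; exists e; split=> // M.
  apply: contrapT => L; apply: K; exists M => n Mn.
  by rewrite ltNge; apply/negP => en; apply: L; exists n.
exists e => //; have [M hM] := padic_cauchyP u e0; exists M => n Mn.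
have [k Mk ek] := he M; rewrite leNgt; apply/negP => ne.
have := padic_absqD_lt ne (hM _ _ Mk Mn).
by rewrite addrC subrK ltNge ek.
Qed.

Lemma padic_cauchyV (u : padic_cauchy p) : u \notin @padic_null p ->
  (fun n => (u n)^-1) \in padic_cauchy_pred p.
Proof.
move=> /padic_not_null[d d0 [M hM]]; apply/asboolP => e e0.
have [K hK] := padic_cauchyP u (mulr_gt0 e0 (mulr_gt0 d0 d0)).
exists (maxn M K) => m n; rewrite !geq_max => /andP[Mm Km] /andP[Mn Kn].
have pos k : (M <= k)%N -> 0 < abs_p (u k) by move=> /hM; exact: lt_le_trans.
have nz k : (M <= k)%N -> u k != 0.
  by move=> /pos; apply: contraTneq => ->; rewrite padic_absq0 ltxx.
have -> : (u m)^-1 - (u n)^-1 = (u n - u m) / (u m * u n).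
  by field; rewrite !nz.
rewrite padic_absqM padic_absqV padic_absqM ltr_pdivrMr ?mulr_gt0 ?pos //.
apply: lt_le_trans (hK _ _ Kn Km) _; rewrite ler_pM2l //.
by apply: ler_pM; rewrite ?(ltW d0) ?hM.
Qed.

Definition padic_cauchy_inv (u : padic_cauchy p) : padic_cauchy p :=
  match boolP (u \in @padic_null p) with
  | AltTrue _ => 0
  | AltFalse nu => PadicCauchy (padic_cauchyV nu)
  end.

Local Open Scope quotient_scope.

Definition padic_inv (x : padic p) : padic p := \pi_(padic p) (padic_cauchy_inv (repr x)).

Lemma padic_pi_eq0 (u : padic_cauchy p) :
  (\pi_(padic p) u == 0) = (u \in @padic_null p).
Proof. by rewrite -[0]pi_zeror -Quotient.idealrBE subr0. Qed.

Lemma padic_mulVf (x : padic p) : x != 0 -> padic_inv x * x = 1.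
Proof.
rewrite -{1}[x]reprK padic_pi_eq0 => nu.
have -> : padic_inv x * x = \pi_(padic p) (padic_cauchy_inv (repr x) * repr x).
  by rewrite rmorphM /= reprK.
rewrite -(rmorph1 \pi_(padic p)).
apply/eqP; rewrite -Quotient.idealrBE; apply/asboolP => e e0.
rewrite /padic_cauchy_inv; case: {-}_ / boolP => [nu'|nu']; first by rewrite nu' in nu.
have [d d0 [M hM]] := padic_not_null nu.
exists M => n Mn.
have nz : repr x n != 0.
  by apply: contraTneq (lt_le_trans d0 (hM _ Mn)) => ->; rewrite padic_absq0 ltxx.
have H : (PadicCauchy (padic_cauchyV nu') * repr x - 1 : padic_cauchy p) n = 0.
  change ((repr x n)^-1 * repr x n - 1 = 0).
  by rewrite mulVf // subrr.
by rewrite -[ltLHS](congr1 (padic_absq p) (esym H)) padic_absq0.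
Qed.

Lemma padic_inv0 : padic_inv 0 = 0.
Proof.
have n0 : repr (0 : padic p) \in @padic_null p.
  by rewrite -padic_pi_eq0 reprK.
rewrite /padic_inv.
have -> : padic_cauchy_inv (repr (0 : padic p)) = 0.
  move: (repr _) n0 => u n0; rewrite /padic_cauchy_inv.
  by case: {-}_ / boolP => // nu; case/negP: (nu).
exact: pi_zeror.
Qed.

HB.instance Definition _ :=
  GRing.ComNzRing_isField.Build (padic p) padic_mulVf padic_inv0.

End PadicField.

Lemma padic_absq_eq p (r s : rat) :
  padic_absq p (r - s) < padic_absq p s -> padic_absq p r = padic_absq p s.
Proof.
move=> h; apply/eqP; rewrite eq_le; apply/andP; split.
  by have := padic_absqD p (r - s) s; rewrite subrK (max_idPr (ltW h)).
rewrite leNgt; apply/negP => rs.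
have h' : padic_absq p (s - r) < padic_absq p s by rewrite padic_absqB.
by have := padic_absqD_lt h' rs; rewrite subrK ltxx.
Qed.

Section PadicAbs.
Variables (R : realType) (p : nat).

Definition padic_abs (x : padic p) : R :=
  limn (fun n => ratr (padic_absq p (repr x n)) : R).

Lemma padic_null_cvg (u : nat -> rat) : is_padic_null p u ->
  (fun n => ratr (padic_absq p (u n)) : R) @ \oo --> (0 : R).
Proof.
move=> nu; apply/cvgrPdist_lt => e e0.
have [d /andP[d0 de]] : exists d : rat, 0 < (ratr d : R) < e.
  by have [d dI] := rat_in_itvoo e0; exists d; move: dI; rewrite in_itv.
rewrite ltr0q in d0; have [M hM] := nu _ d0.
exists M => // n /= Mn; rewrite sub0r normrN ger0_norm ?ler0q ?padic_absq_ge0 //.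
by apply: lt_trans de; rewrite ltr_rat; exact: hM.
Qed.

Lemma padic_abs_pi (u : padic_cauchy p) :
  (fun n => ratr (padic_absq p (u n)) : R) @ \oo -->
    padic_abs (\pi_(padic p)%qT u).
Proof.
rewrite /padic_abs; set v := repr _.
have uv : u - v \in @padic_null p.
  by rewrite Quotient.idealrBE; apply/eqP; rewrite [RHS]reprK.
have [nu|nu] := boolP (u \in @padic_null p).
  have nv : v \in @padic_null p by rewrite -(rpredBl _ nu).
  rewrite (cvg_lim _ (padic_null_cvg (asboolW nv))) //.
  exact: padic_null_cvg (asboolW nu).
have [e e0 [M hM]] := padic_not_null nu.
have [K hK] := padic_cauchyP u e0.
have [L hL] := asboolW uv e e0.
pose c : R := ratr (padic_absq p (u (maxn M K))).
have cu : (fun n => ratr (padic_absq p (u n)) : R) @ \oo --> c.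
  apply: cvg_near_cst; exists (maxn M K) => // n /=.
  rewrite geq_max => /andP[Mn Kn]; congr ratr; apply: padic_absq_eq.
  apply: lt_le_trans (hK _ _ Kn (leq_maxr _ _)) _.
  exact: hM (leq_maxl _ _).
suff cv : (fun n => ratr (padic_absq p (v n)) : R) @ \oo --> c.
  by rewrite (cvg_lim _ cv).
apply: cvg_trans cu; apply: near_eq_cvg; exists (maxn M L) => // n /=.
rewrite geq_max => /andP[Mn Ln]; congr ratr; apply/esym/padic_absq_eq.
by rewrite padic_absqB; apply: lt_le_trans (hL _ Ln) (hM _ Mn).
Qed.

Definition padic_series_sum (u : nat -> padic p) (l : padic p) : Prop :=
  (fun n => padic_abs (series u n - l)) @ \oo --> (0 : R).

End PadicAbs.

Definition rising (a k : nat) : nat := \prod_(i < k) (a + i).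

(* The exponents with "- 1" are integer powers: for n = delta = 0 they equal -1. *)
Definition summand (F : fieldType) (q : rat) (gamma delta N : nat) (x : F)
    (n : nat) : F :=
  let m := (gamma * n + delta)%N in
  let m' := (gamma * n.+1 + delta)%N in
  (m`!%:R ^ (m%:Z - 1)) * x ^+ (gamma * n) *
  ((m'`!%:R ^+ gamma * (rising m.+1 gamma)%:R ^ (m%:Z - 1))
     / (ratr q + m'`!%:R ^+ (N * m')) * x ^+ gamma
   - 1 / (ratr q + m`!%:R ^+ (N * m))).

Definition closed_sum (F : fieldType) (q : rat) (delta N : nat) : F :=
  - (delta`!%:R ^ (delta%:Z - 1) / (ratr q + delta`!%:R ^+ (N * delta))).

(* Main.v *)
(* With m = gamma n + delta, the summand is a_(n+1) - a_n for
   a_n = (m!)^(m-1) x^(gamma n) / (q + (m!)^(N m)), so the sum up to n is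
   a_n - a_0, and it remains to see that a_n tends to 0.  Over the reals
   |a_n| <= X^m / m! with X = max(1, |x|).  In Q_p, m! tends to 0, so the
   denominator eventually has absolute value |q|_p, and
   |a_n|_p <= (|m!|_p X)^(m-1) X / |q|_p. *)
Require Import Defs.
From mathcomp Require Import all_boot all_order all_algebra.
From mathcomp Require Import ring.
From mathcomp Require Import boolp classical_sets functions reals topology.
From mathcomp Require Import normedtype sequences.
From HB Require Import structures.
Import Order.TTheory GRing.Theory Num.Theory.
Import numFieldNormedType.Exports.
Local Open Scope classical_set_scope.
Local Open Scope ring_scope.

(** * Telescoping of the summand *)

Definition term {F : fieldType} (q : rat) (gamma delta N : nat) (x : F)
    (n : nat) : F :=
  let m := (gamma * n + delta)%N in
  m`!%:R ^ (m%:Z - 1) / (ratr q + m`!%:R ^+ (N * m)) * x ^+ (gamma * n).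

Lemma fact_rising (m k : nat) : (m + k)`! = (m`! * rising m.+1 k)%N.
Proof.
elim: k => [|k IH]; first by rewrite /rising big_ord0 addn0 muln1.
by rewrite /rising big_ord_recr /= addnS factS IH addSn [RHS]mulnA mulnC.
Qed.

(** With m' = m + gamma one has m'! = m! (m+1)_gamma and m' - 1 = gamma + (m - 1), so (m'!)^(m'-1)
    splits into the factors of the summand. Adding exponents requires m'! to be nonzero in [F],
    because m - 1 may be -1. *)
Lemma summand_telescope (F : fieldType) (q : rat) (gamma delta N : nat) (x : F)
    (n : nat) : (forall k, k.+1%:R != 0 :> F) ->
  summand q gamma delta N x n =
  term q gamma delta N x n.+1 - term q gamma delta N x n.
Proof.
move=> char0; rewrite /summand /term /=.
set m := (gamma * n + delta)%N.
have -> : (gamma * n.+1 + delta)%N = (m + gamma)%N by rewrite mulnS -addnA addnC.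
rewrite mulrBr mul1r mulnS [(gamma + _)%N]addnC; congr (_ - _); last by rewrite mulrAC.
have fact0 : (m + gamma)`!%:R != 0 :> F.
  by rewrite -(prednK (fact_gt0 (m + gamma))) char0.
have -> : (m + gamma)`!%:R ^ ((m + gamma)%:Z - 1)
    = (m + gamma)`!%:R ^+ gamma * (m`!%:R ^ (m%:Z - 1)
      * (rising m.+1 gamma)%:R ^ (m%:Z - 1)) :> F.
  rewrite -expfzMl -natrM -fact_rising exprnP -expfzDr //; congr (_ ^ _).
  by rewrite PoszD addrAC addrC.
rewrite exprD; set D := (ratr q + _)^-1.
by ring.
Qed.

(** * Rationals inside Q_p and the multiplicative absolute value *)

Section PadicEmbedding.
Variable p : nat.
Local Open Scope quotient_scope.

Lemma const_padic_cauchy (r : rat) : (fun=> r) \in padic_cauchy_pred p.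
Proof.
by apply/asboolP => e e0; exists 0 => m n _ _; rewrite subrr padic_absq0.
Qed.

Definition padic_of_rat (r : rat) : padic p :=
  \pi_(padic p) (PadicCauchy (const_padic_cauchy r)).

Lemma padic_of_rat_is_zmod : zmod_morphism padic_of_rat.
Proof.
move=> r s; rewrite /padic_of_rat -rmorphB; congr \pi.
by apply: val_inj; apply/funext.
Qed.

Lemma padic_of_rat_is_monoid : monoid_morphism padic_of_rat.
Proof.
split=> [|r s].
  rewrite /padic_of_rat -(rmorph1 \pi_(padic p)); congr \pi.
  by apply: val_inj; apply/funext.
rewrite /padic_of_rat -rmorphM; congr \pi.
by apply: val_inj; apply/funext.
Qed.

HB.instance Definition _ :=
  GRing.isZmodMorphism.Build rat (padic p) padic_of_rat padic_of_rat_is_zmod.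
HB.instance Definition _ :=
  GRing.isMonoidMorphism.Build rat (padic p) padic_of_rat padic_of_rat_is_monoid.

(** Turns the [ratr] of [summand] into the class of a constant sequence, whose absolute value is
    computed in Q. *)
Lemma ratr_padic (r : rat) : ratr r = padic_of_rat r.
Proof. by rewrite -[in RHS](divq_num_den r) fmorph_div !rmorph_int. Qed.

Lemma padic_char0 (k : nat) : k.+1%:R != 0 :> padic p.
Proof. by rewrite -(rmorph_nat padic_of_rat) fmorph_eq0 pnatr_eq0. Qed.

(** [padic_abs_pi] allows any representative, so the pointwise product of representatives of x and y
    serves for x * y; uniqueness of limits concludes. *)
Lemma padic_absM (R : realType) (x y : padic p) :
  padic_abs R (x * y) = padic_abs R x * padic_abs R y.
Proof.
rewrite -(reprK x) -(reprK y) -rmorphM.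
have H := @padic_abs_pi R p (repr x * repr y).
apply: cvg_unique H _; first exact: norm_hausdorff.
have E n : ratr (padic_absq p ((repr x * repr y : padic_cauchy p) n))
    = ratr (padic_absq p (repr x n)) * ratr (padic_absq p (repr y n)) :> R.
  by rewrite -rmorphM -padic_absqM.
by rewrite (funext E); apply: cvgM; exact: padic_abs_pi.
Qed.

Lemma padic_abs_rat (R : realType) (r : rat) :
  padic_abs R (padic_of_rat r) = ratr (padic_absq p r).
Proof.
have H := @padic_abs_pi R p (PadicCauchy (const_padic_cauchy r)).
by apply: cvg_unique H _; [exact: norm_hausdorff|apply: cvg_near_cst; exact: nearW].
Qed.

Lemma padic_absX (R : realType) (x : padic p) n :
  padic_abs R (x ^+ n) = padic_abs R x ^+ n.
Proof.
elim: n => [|n IH]; last by rewrite !exprS padic_absM IH.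
by rewrite !expr0 -(rmorph1 padic_of_rat) padic_abs_rat padic_absq1 rmorph1.
Qed.

Lemma padic_abs_ge0 (R : realType) (x : padic p) : 0 <= padic_abs R x.
Proof.
rewrite -(reprK x).
have H := @padic_abs_pi R p (repr x).
rewrite -(cvg_lim _ H) //; apply: limr_ge; first by apply/cvg_ex; eexists; exact: H.
by apply: nearW => n; rewrite ler0q padic_absq_ge0.
Qed.
End PadicEmbedding.

(** * Factorials in the p-adic absolute value *)

Lemma padic_absqX p (r : rat) n : padic_absq p (r ^+ n) = padic_absq p r ^+ n.
Proof. by elim: n => [|n IH]; rewrite ?padic_absq1 // !exprS padic_absqM IH. Qed.

Lemma padic_absq_nat_le1 p n : padic_absq p n%:R <= 1.
Proof.
elim: n => [|n IH]; first by rewrite padic_absq0.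
rewrite mulrS; apply: le_trans (padic_absqD _ _ _) _.
by rewrite ge_max padic_absq1 lexx.
Qed.

Lemma padic_absq_prime p : prime p -> padic_absq p p%:R = p%:R^-1.
Proof.
move=> pp; rewrite /padic_absq pnatr_eq0 (gtn_eqF (prime_gt0 pp)).
rewrite /padic_val (_ : p%:R = p%:Z%:~R) // numq_int denq_int logn1 subr0.
by rewrite absz_nat logn_prime // eqxx.
Qed.

(** For n >= p^k the number p^k is itself a factor of n!, whence |n!|_p <= p^-k. *)
Lemma fact_padic_null p : prime p -> is_padic_null p (fun n => n`!%:R).
Proof.
move=> pp e e0.
have p1 := prime_gt1 pp.
(* Since p^k > k, this choice gives p^-k < e. *)
have [k ke] : exists k : nat, e^-1 < k%:R :> rat.
  by exists (Num.bound e^-1); apply: archi_boundP; rewrite invr_ge0 ltW.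
exists (p ^ k)%N => n kn.
have /dvdnP[j ->] : (p ^ k %| n`!)%N.
  by apply: dvdn_fact; rewrite kn expn_gt0 prime_gt0.
rewrite natrM padic_absqM; apply: le_lt_trans (ler_piMl _ (padic_absq_nat_le1 _ _)) _.
  exact: padic_absq_ge0.
rewrite natrX padic_absqX padic_absq_prime // exprVn invf_plt ?posrE ?exprn_gt0 ?ltr0n ?prime_gt0 //.
by rewrite -natrX; apply: lt_trans ke _; rewrite ltr_nat ltn_expl.
Qed.

(** * Decay of the terms over the reals and in Q_p *)

Lemma cvg_affine (gamma delta : nat) : (0 < gamma)%N ->
  (fun n => gamma * n + delta)%N @ \oo --> \oo.
Proof.
move=> g0 A [M _ MA]; exists M => // n /= Mn; apply: MA => /=.
by apply: leq_trans Mn (leq_trans (leq_pmull _ g0) (leq_addr _ _)).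
Qed.

Lemma term_real_bound (R : realType) (q : rat) (gamma delta N : nat) (x : R) n :
  0 < q -> (0 < N)%N ->
  `|term q gamma delta N x n|
    <= Num.max 1 `|x| ^+ (gamma * n + delta) / (gamma * n + delta)`!%:R.
Proof.
move=> q0 N0; rewrite /term; set m := (gamma * n + delta)%N.
(* X >= 1 lets the exponent gamma n be raised to m, which yields a coefficient of the exponential
   series. *)
set M : R := m`!%:R; set X := Num.max 1 `|x|.
have M1 : 1 <= M by rewrite ler1n fact_gt0.
have M0 : 0 < M := lt_le_trans ltr01 M1.
have X1 : 1 <= X by rewrite le_max lexx.
have MN : 0 < M ^+ (N * m) by rewrite exprn_gt0.
have D0 : 0 < ratr q + M ^+ (N * m) by rewrite addr_gt0 // ltr0q.
rewrite !normrM normfV normrX (gtr0_norm D0) gtr0_norm ?exprz_gt0 //.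
rewrite mulrC; apply: ler_pM.
- by rewrite exprn_ge0.
- by rewrite divr_ge0 ?exprz_ge0 ?ltW.
- apply: le_trans (_ : _ <= X ^+ (gamma * n)) _.
    by rewrite lerXn2r ?nnegrE ?normr_ge0 ?(le_trans ler01) // le_max lexx orbT.
  by apply: ler_weXn2l => //; apply: leq_addr.
(* As M^(m-1) = M^m / M, it suffices that M^m <= M^(N m) <= q + M^(N m). *)
- rewrite ler_pdivrMr // expfzDr ?gt_eqF // -exprnP mulrC.
  rewrite ler_pM2l ?invr_gt0 // (le_trans (_ : _ <= M ^+ (N * m))) //.
    by apply: ler_weXn2l => //; apply: leq_pmull.
  by rewrite lerDr ler0q ltW.
Qed.

Lemma cvg_term_real (R : realType) (q : rat) (gamma delta N : nat) (x : R) :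
  0 < q -> (0 < gamma)%N -> (0 < N)%N ->
  term q gamma delta N x @ \oo --> (0 : R).
Proof.
move=> q0 g0 N0; apply/norm_cvg0P.
apply: (@squeeze_cvgr _ _ _ _ (cst 0)
  (fun n => Num.max 1 `|x| ^+ (gamma * n + delta) / (gamma * n + delta)`!%:R)).
- by apply: nearW => n; rewrite normr_ge0 term_real_bound.
- exact: cvg_cst.
- exact: (cvg_comp _ _ (cvg_affine gamma delta g0) (cvg_exp_coeff _)).
Qed.

(** The bound (t X)^(m-1) X / |q|_p becomes linear in t, because t X <= 1 and m - 1 >= 1 give (t
    X)^(m-1) <= t X. *)
Lemma padic_term_bound (R : realType) p q gamma delta N (x : padic p) n :
  let m := (gamma * n + delta)%N in
  let X := Num.max 1 (padic_abs R x) in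
  let t : R := ratr (padic_absq p m`!%:R) in
  (0 < N)%N -> (1 < m)%N ->
  padic_absq p m`!%:R < padic_absq p q -> t * X <= 1 ->
  padic_abs R (term q gamma delta N x n)
    <= t * (X ^+ 2 / ratr (padic_absq p q)).
Proof.
move=> m X t N0 m1 tq tX.
have t0 : 0 <= t by rewrite ler0q padic_absq_ge0.
have X1 : 1 <= X by rewrite le_max lexx.
have X0 : 0 <= X := le_trans ler01 X1.
(* The coefficient of x^(gamma n) is rational; m >= 1 makes its exponent m - 1 a natural number. *)
have -> : term q gamma delta N x n = padic_of_rat p
    (m`!%:R ^+ m.-1 / (q + m`!%:R ^+ (N * m))) * x ^+ (gamma * n).
  rewrite /term -/m ratr_padic fmorph_div /= [padic_of_rat p (_ + _)]rmorphD /=.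
  by rewrite !rmorphXn /= !rmorph_nat -(predn_int (ltnW m1)).
rewrite padic_absM padic_abs_rat padic_absX padic_absqM padic_absqV.
(* The ultrametric inequality lets q dominate: |m!^(N m)|_p <= |m!|_p < |q|_p, as N m >= 1. *)
have -> : padic_absq p (q + m`!%:R ^+ (N * m)) = padic_absq p q.
  apply: padic_absq_eq; rewrite addrAC subrr add0r.
  apply: le_lt_trans tq; rewrite padic_absqX; apply: ler_iXnr.
  - by rewrite muln_gt0 N0 ltnW.
  - exact: padic_absq_ge0.
  - exact: padic_absq_nat_le1.
rewrite fmorph_div padic_absqX rmorphXn -/t mulrAC mulrA ler_wpM2r //.
  by rewrite invr_ge0 ler0q padic_absq_ge0.
apply: (@le_trans _ _ (t ^+ m.-1 * X ^+ m)).
  apply: ler_wpM2l; first exact: exprn_ge0.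
  apply: le_trans (_ : _ <= X ^+ (gamma * n)) _.
    by rewrite lerXn2r ?nnegrE ?padic_abs_ge0 ?(le_trans ler01) // le_max lexx orbT.
  by apply: ler_weXn2l => //; apply: leq_addr.
rewrite -[in X ^+ m](prednK (ltnW m1)) exprSr mulrA -exprMn expr2 mulrA.
apply: ler_wpM2r => //; apply: ler_iXnr => //; last exact: mulr_ge0.
by rewrite -ltnS (prednK (ltnW m1)).
Qed.

Lemma cvg_padic_term (R : realType) p q gamma delta N (x : padic p) :
  prime p -> q != 0 -> (0 < gamma)%N -> (0 < N)%N ->
  (fun n => padic_abs R (term q gamma delta N x n)) @ \oo --> (0 : R).
Proof.
move=> pp q0 g0 N0.
pose t n : R := ratr (padic_absq p (gamma * n + delta)`!%:R).
pose X : R := Num.max 1 (padic_abs R x).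
have m_infty := cvg_affine gamma delta g0.
have t0 : t @ \oo --> (0 : R).
  exact: (cvg_comp _ _ m_infty (padic_null_cvg (fact_padic_null p pp))).
have X1 : 1 <= X by rewrite le_max lexx.
have X0 : 0 < X := lt_le_trans ltr01 X1.
apply: (@squeeze_cvgr _ _ _ _ (cst 0)
  (fun n => t n * (X ^+ 2 / ratr (padic_absq p q)))).
(* All three conditions of [padic_term_bound] hold eventually; |q|_p > 0 serves as the epsilon for
   the factorials. *)
- have [K hK] := fact_padic_null p pp _ (padic_absq_gt0 p q0).
  have tX : \forall n \near \oo, t n <= X^-1.
    by apply: (cvgr_le _ t0); rewrite invr_gt0.
  have m_gt1 := m_infty _ (nbhs_infty_gt 1).
  have m_geK := m_infty _ (nbhs_infty_ge K).
  near=> n; rewrite padic_abs_ge0 padic_term_bound //.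
  + by near: n; exact: m_gt1.
  + by apply: hK; near: n; exact: m_geK.
  + by rewrite -ler_pdivlMr // div1r; near: n.
- exact: cvg_cst.
- by rewrite -(mul0r (X ^+ 2 / ratr (padic_absq p q))); apply: cvgM t0 (cvg_cst _).
Unshelve. all: by end_near.
Qed.

(** * Partial sums and the conclusion *)

(** [series] at n adds the indices below n, so it telescopes to a_n - a_0, and the closed sum is
    -a_0. *)
Lemma series_summand (F : fieldType) q gamma delta N (x : F) n :
  (forall k, k.+1%:R != 0 :> F) ->
  series (summand q gamma delta N x) n - closed_sum F q delta N =
  term q gamma delta N x n.
Proof.
move=> char0; rewrite /series /=.
under eq_bigr do rewrite summand_telescope //.
rewrite telescope_sumr // /closed_sum opprK {2}/term muln0 add0n expr0 mulr1.
exact: subrK.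
Qed.

Theorem theorem4p9 (R : realType) (q : rat) (gamma delta N : nat)
    (hq : 0 < q) (hgamma : (0 < gamma)%N) (hN : (0 < N)%N) :
  (forall x : R, x != 0 ->
     series (summand q gamma delta N x) @ \oo --> closed_sum R q delta N) /\
  (forall p : nat, prime p -> forall x : padic p, x != 0 ->
     padic_series_sum R (summand q gamma delta N x)
                        (closed_sum (padic p) q delta N)).
Proof.
split=> [x _|p pp x _].
  have char0 k : k.+1%:R != 0 :> R by rewrite pnatr_eq0.
  apply/subr_cvg0; under eq_fun do rewrite series_summand //.
  exact: cvg_term_real.
rewrite /padic_series_sum.
have char0 := padic_char0 p.
under eq_fun do rewrite series_summand //.
by apply: cvg_padic_term => //; rewrite gt_eqF.
Qed.
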